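(* For every $2$-coloring $\mathbb{N}=A_1\cup A_2$ (a partition of $\mathbb{N}$ into two sets), either $(A_1-A_1)\cup(A_2-A_2)\supseteq\mathbb{N}$, or there exists $d\in\mathbb{N}$ for which $d\mathbb{N}\subseteq(A_1-A_1)\cap(A_2-A_2)$. In particular, the set $(A_1-A_1)\cup(A_2-A_2)$ is a Bohr$_0$ set.
   Context: $\mathbb{N}=\{1,2,\ldots\}$. For $A\subseteq\mathbb{N}$, $A-A=\{a-b : a,b\in A\}\subseteq\mathbb{Z}$, and $d\mathbb{N}=\{dn:n\in\mathbb{N}\}$. A set of integers is a Bohr$_0$ set if it contains $\{n\in\mathbb{N}:\|n\alpha\|<\delta\}$ for some $\delta>0$, $D\in\mathbb{N}$ and $\alpha\in\mathbb{T}^D=(\mathbb{R}/\mathbb{Z})^D$, where $\|\cdot\|$ is the distance to $0$ in $\mathbb{T}^D$. *)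

(* Defs.v *)
From HB Require Import structures.
From mathcomp Require Import all_boot all_order all_algebra.
From mathcomp Require Import all_classical all_reals.
Set Implicit Arguments.
Unset Strict Implicit.
Unset Printing Implicit Defensive.
Import Order.TTheory GRing.Theory Num.Theory.
Local Open Scope ring_scope.
Local Open Scope quotient_scope.
Local Open Scope classical_set_scope.

(* The natural numbers of the statement start at 1. *)
Definition posnat : set nat := [set n | (0 < n)%N].

Definition posnatZ : set int := [set n%:Z | n in posnat].

Definition posnat_multiples (d : nat) : set int :=
  [set (d * n)%N%:Z | n in posnat].

(* All a - b with a and b ranging independently over A, computed in int
   (so no truncation). *)
Definition difference_set (A : set nat) : set int :=
  [set a%:Z - b%:Z | a in A & b in A].

(* R / Z as an additive group; Num.int_num_subdef is the predicate underlying
   Num.int. *)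
Definition torus (R : realType) : Type :=
  Quotient.quot (GRing.ZmodClosed.clone R (@Num.int_num_subdef R) _).
HB.instance Definition _ (R : realType) := GRing.Zmodule.on (torus R).
HB.instance Definition _ (R : realType) := Quotient.on (torus R).

(* Distance to 0 in R / Z: the infimum of `|x| over all real lifts x of t. *)
Definition torus_norm (R : realType) (t : torus R) : R :=
  inf [set `|x| | x in [set x : R | \pi_(torus R) x = t]].

(* Distance to 0 in (R / Z)^D, for the sup metric; all the usual product
   metrics define the same Bohr_0 sets. *)
Definition torusn_norm (R : realType) (D : nat) (a : 'rV[torus R]_D) : R :=
  \big[Num.max/0]_(i < D) torus_norm (a ord0 i).

Definition bohr0 (R : realType) (E : set int) : Prop :=
  exists delta : R, exists D : nat, exists alpha : 'rV[torus R]_D,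
    [/\ 0 < delta, (0 < D)%N &
      [set n%:Z | n in [set n | posnat n /\ torusn_norm (alpha *+ n) < delta]]
        `<=` E].

(* Main.v *)
(** If some [d >= 1] is not in [(A1 - A1) U (A2 - A2)], then [n] and [n + d]
    always have different colors, so the coloring is [2d]-periodic and takes
    both colors: all multiples of [2d] lie in [A1 - A1] and in [A2 - A2].
    For the Bohr property, [|| n / d || < 1 / d] exactly when [d] divides [n]. *)
Require Import Defs.
From mathcomp Require Import all_boot all_order all_algebra.
From mathcomp Require Import all_classical all_reals.
Import Order.TTheory GRing.Theory Num.Theory.
Local Open Scope quotient_scope.
Local Open Scope ring_scope.
Local Open Scope classical_set_scope.

(* [torus R] does not inherit the quotient-group instances of the ideal
   quotient it unfolds to, so that type is written out to reach its lemmas. *)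
Lemma torus_piMn (R : realType) (x : R) (n : nat) :
  \pi_(torus R) (x *+ n) = \pi_(torus R) x *+ n.
Proof.
exact: (raddfMn (\pi_(Quotient.quot
  (GRing.ZmodClosed.clone R (@Num.int_num_subdef R) _))) n x).
Qed.

Lemma torus_pi_eq (R : realType) (x y : R) :
  \pi_(torus R) x = \pi_(torus R) y -> x - y \is a Num.int.
Proof.
move=> /eqP; rewrite -[_ == _]/(_ == _ %[mod (Quotient.quot
  (GRing.ZmodClosed.clone R (@Num.int_num_subdef R) _))]).
by rewrite -Quotient.idealrBE.
Qed.

(** Two lifts of one point of the torus differ by an integer, so the infimum defining [torus_norm]
    runs only over numbers of the form [x + m]. *)
Lemma torus_norm_ge (R : realType) (x e : R) :
  (forall m : int, e <= `|x + m%:~R|) -> e <= torus_norm (\pi_(torus R) x).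
Proof.
move=> xe; apply: lb_le_inf; first by exists `|x|; exists x.
move=> _ [y /= /torus_pi_eq/intrP[m yx] <-].
by rewrite -(subrK x y) yx addrC.
Qed.

(** Every lift of n/d has the form (n + d m)/d, and its integer numerator is nonzero when d does not
    divide n. *)
Lemma torus_norm_divn_ge (R : realType) (d n : nat) :
  (0 < d)%N -> ~~ (d %| n)%N ->
  d%:R^-1 <= torus_norm (\pi_(torus R) (n%:R / d%:R)).
Proof.
move=> d_gt0 dNn; apply: torus_norm_ge => m.
have d_pos : 0 < d%:R :> R by rewrite ltr0n.
rewrite -[X in X + _](mulrC _) -[X in _ + X](mulKf (lt0r_neq0 d_pos)).
rewrite -mulrDr normrM ger0_norm ?invr_ge0 ?ler0n //.
rewrite ler_peMr ?invr_ge0 ?ler0n //.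
(* The bound 1 <= |n + d m| is moved to [int], where it says that n + d m is nonzero. *)
rewrite !(pmulrn 1) -intrM -intrD -intr_norm ler1z -gtz0_ge1 normr_gt0.
apply: contra dNn => /eqP/(canRL (addrK _)); rewrite sub0r => nE.
by apply/(@dvdzP d n); exists (- m); rewrite nE mulNr mulrC.
Qed.

Lemma bohr0_multiples (R : realType) (d : nat) (E : set int) :
  (0 < d)%N -> posnat_multiples d `<=` E -> bohr0 R E.
Proof.
(* One coordinate suffices: both the radius and the rotation are 1/d. *)
move=> d_gt0 dE; exists d%:R^-1, 1%N, (const_mx (\pi_(torus R) d%:R^-1)).
split=> //; first by rewrite invr_gt0 ltr0n.
move=> _ [n [n_gt0 n_small] <-]; apply: dE.
have /dvdnP[k nE] : (d %| n)%N.
  apply: contraLR n_small => /(torus_norm_divn_ge R _ _ d_gt0) norm_ge.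
  rewrite -leNgt /torusn_norm big_ord_recl le_max mulmxnE mxE -torus_piMn.
  by rewrite -[_ *+ n]mulr_natl norm_ge.
exists k; last by rewrite nE mulnC.
by move: n_gt0; rewrite /posnat /= nE muln_gt0 => /andP[].
Qed.

Lemma difference_setD (A : set nat) (n d : nat) :
  A n -> A (n + d)%N -> difference_set A d%:Z.
Proof. by exists (n + d)%N => //; exists n => //; rewrite PoszD addrC addKr. Qed.

Lemma color_change_multiples (A B : set nat) (d : nat) :
  A `|` B = posnat ->
  ~ difference_set A d%:Z -> ~ difference_set B d%:Z ->
  posnat_multiples (d + d) `<=` difference_set A `&` difference_set B.
Proof.
move=> AUB dNA dNB.
have pos n : A n \/ B n -> posnat n by rewrite -AUB.
have shift_pos n : posnat n -> A (n + d)%N \/ B (n + d)%N.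
  by move=> n_gt0; rewrite -[_ \/ _]/((A `|` B) (n + d)%N) AUB; exact: ltn_addr.
have AB n : A n -> B (n + d)%N.
  move=> An; have [And|//] := shift_pos n (pos n (or_introl An)).
  by case: dNA; exact: difference_setD An And.
have BA n : B n -> A (n + d)%N.
  move=> Bn; have [//|Bnd] := shift_pos n (pos n (or_intror Bn)).
  by case: dNB; exact: difference_setD Bn Bnd.
(* One shift by [d] swaps the colors, so two shifts restore them. *)
have periodA n k : A n -> A (n + (d + d) * k)%N.
  by move=> An; elim: k => [|k /AB/BA]; rewrite ?muln0 ?addn0 // mulnSr !addnA.
have periodB n k : B n -> B (n + (d + d) * k)%N.
  by move=> Bn; elim: k => [|k /BA/AB]; rewrite ?muln0 ?addn0 // mulnSr !addnA.
(* Both colors occur: [1] has one of them and [1 + d] the other. *)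
have [a [b [Aa Bb]]] : exists a b, A a /\ B b.
  have [A1|B1] : (A `|` B) 1%N by rewrite AUB.
    by exists 1%N, (1 + d)%N; split=> //; exact: AB.
  by exists (1 + d)%N, 1%N; split=> //; exact: BA.
move=> _ [k _ <-]; split.
  exact: difference_setD Aa (periodA a k Aa).
exact: difference_setD Bb (periodB b k Bb).
Qed.

Theorem theorem4p9 (R : realType) (A1 A2 : set nat)
    (hcover : A1 `|` A2 = posnat) (hdisj : A1 `&` A2 = set0) :
  (posnatZ `<=` difference_set A1 `|` difference_set A2 \/
   exists2 d : nat, posnat d &
     posnat_multiples d `<=` difference_set A1 `&` difference_set A2)
  /\ bohr0 R (difference_set A1 `|` difference_set A2).
Proof.
have dichotomy : posnatZ `<=` difference_set A1 `|` difference_set A2 \/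
    exists2 d : nat, posnat d &
      posnat_multiples d `<=` difference_set A1 `&` difference_set A2.
  (* If the first alternative fails, some positive [d] is missing from both difference sets. *)
  have [|/existsNP[_ /not_implyP[[d d_gt0 <-] /not_orP[dN1 dN2]]]] :=
    pselect (posnatZ `<=` difference_set A1 `|` difference_set A2); first by left.
  right; exists (d + d)%N; first by rewrite /posnat /= addn_gt0 d_gt0.
  exact: color_change_multiples.
split=> //; case: dichotomy => [all_diff|[d d_gt0 d_diff]].
  (* In the first alternative, the union contains all multiples of 1. *)
  apply: (@bohr0_multiples R 1%N) => // _ [n n_gt0 <-].
  by apply: all_diff; exists n => //; rewrite mul1n.
by apply: (@bohr0_multiples R d) => // x /d_diff[x1 _]; left.
Qed.
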